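(* Let $X$ be a Banach space, $\{T(t)\}_{t\ge 0}$ a bounded $C_0$-semigroup on $X$, $\mathcal S=\{T(t):t\ge0\}$, and let $\mathcal S_0\subset L(X,X^{**})$ be its compactification. Then $\mathcal S_0$ is $w^*OT$-compact in $L(X,X^{**})$, and for every $V\in\mathcal S_0$: (1) $V^*T^*(t)x^{\odot}=T^*(t)V^*x^{\odot}$ for all $x^{\odot}\in X^{\odot}$ and $t\ge 0$; (2) $V^*(X^{\odot})\subset X^{\odot}$; (3) $V^{\odot *}(X^{\odot\odot})\subset X^{\odot\odot}$; consequently $Vx\in X^{\odot\odot}$ for all $x\in X$. Summarizing, $\mathcal S_0\subset L_T(X,X^{\odot\odot})$ and $\mathcal S_0$ is $\kappa^{\odot\odot}$-compact.
   Context: Sun duals: $X^{\odot}=\{x^*\in X^*:\lim_{t\to0}\|T^*(t)x^*-x^*\|=0\}$, a norm-closed, weak*-dense, $T^*(t)$-invariant subspace of $X^*$; $T^{\odot}(t)=T^*(t)|_{X^{\odot}}$ is a $C_0$-semigroup on $X^\odot$. Likewise $X^{\odot\odot}=\{\varphi\in X^{\odot *}:\lim_{t\to0}\|(T^{\odot}(t))^*\varphi-\varphi\|=0\}$. Compactification: $j_{X^*}:X^*\to X^{***}$ is the natural embedding and $\eta:L(X,X^{**})\to L(X^* )$ is $\eta(U)=U^*j_{X^*}$, i.e. $\langle x,\eta(U)x^*\rangle=\langle Ux,x^*\rangle$. For Banach spaces $E,F$, the $w^*OT$ topology on $L(E,F^* )$ is given by: $T_\lambda\to T$ iff $\langle T_\lambda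 e,f\rangle\to\langle Te,f\rangle$ for all $e\in E,f\in F$. $X\subset X^{**}$ canonically, so $\mathcal S\subset L(X)\subset L(X,X^{**})$. Then $\mathcal S_0:=\eta^{-1}(\overline{\eta(\mathcal S)}^{\,w^*OT})$ (equivalently the $w^*OT$-closure of $\mathcal S$ in $L(X,X^{**})$). For $V\in L(X,X^{**})$ and $x^*\in X^*$, $V^*x^*$ means $V^*j_{X^*}x^*\in X^*$, i.e. the functional $x\mapsto\langle Vx,x^*\rangle$. If $V^*(X^\odot)\subset X^\odot$, then $V^{\odot}\in L(X^\odot)$ is the restriction of $V^*j_{X^*}$ to $X^\odot$ and $V^{\odot*}:=(V^\odot)^*\in L(X^{\odot*})$. Elements of $X^{**}$ are regarded as elements of $X^{\odot *}$ by restriction to $X^\odot$; ''$Vx\in X^{\odot\odot}$'' and ''$\mathcal S_0\subset L_T(X,X^{\odot\odot})$'' are understood through this restriction. $L_T(X,X^{\odot\odot})=\{U\in L(X,X^{\odot\odot}):U^*(X^\odot)\subset X^\odot,\ U^{\odot*}(X^{\odot\odot})\subset X^{\odot\odot}\}$, where for $x^\odot\in X^\odot$, $U^*x^\odot$ is the functional $x\mapsto\langle Ux,x^\odot\rangle$, and $U^{\odot*}=(U^*|_{X^\odot})^*$. The topology $\kappa^{\odot\odot}$ on $L_T(X,X^{\odot\odot})$: $T_\lambda\to T$ iff $\langle T_\lambda x,x^\odot\rangle\to\langle Tx,x^\odot\rangle$ for all $x\in X$, $x^\odot\in X^\odot$. *)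

(* Defs.v *)
From HB Require Import structures.
From mathcomp Require Import all_boot all_order all_algebra.
From mathcomp Require Import complex.
From mathcomp Require Import all_classical all_reals.
From mathcomp Require Import topology normedtype.

Set Implicit Arguments.
Unset Strict Implicit.
Unset Printing Implicit Defensive.

Import Order.TTheory GRing.Theory Num.Def Num.Theory.
Import numFieldNormedType.Exports.

Local Open Scope classical_set_scope.
Local Open Scope ring_scope.

(* Banach spaces are real or complex; both cases are treated at once by
   letting the scalar field depend on a two-valued parameter. *)
Variant scalar_kind := RealScalars | ComplexScalars.

Definition scalar_field (R : realType) (k : scalar_kind) : numFieldType :=
  match k with
  | RealScalars => R : numFieldType
  | ComplexScalars => complex R : numFieldType
  end.

Lemma scalar_supremums (R : realType) (k : scalar_kind)
    (A : set (scalar_field R k)) (M : scalar_field R k) :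
  A !=set0 -> (forall a, A a -> 0 <= a) -> (forall a, A a -> a <= M) ->
  supremums A !=set0.
Proof.
case: k A M => /= A M [a0 Aa0] A0 AM.
  exists (sup A); split; first by apply: sup_upper_bound; split; [exists a0|exists M].
  by move=> b Ab; apply: ge_sup => //; exists a0.
pose B : set R := [set r | A (r%:C)%C].
have AB a : A a -> a = ((complex.Re a)%:C)%C.
  by move=> /A0 a_ge0; rewrite RRe_real// ger0_real.
have B0 : B !=set0 by exists (complex.Re a0); rewrite /B/= -AB.
have BM : has_sup B.
  split=> //; exists (complex.Re M) => r /AM.
  by rewrite lecE => /andP[_].
exists ((sup B)%:C)%C; split.
  move=> a Aa; rewrite (AB a Aa) lecR; apply: sup_upper_bound => //.
  by rewrite /B/= -AB.
move=> b Ab.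
have bI : b = ((complex.Re b)%:C)%C.
  by rewrite RRe_real// ger0_real// (le_trans (A0 _ Aa0))// Ab.
rewrite bI lecR; apply: ge_sup => // r Br.
by have := Ab _ Br; rewrite bI lecR.
Qed.

Section BoundedOperators.
Variables (K : numFieldType) (E F : normedModType K).

Definition bounded_op_pred : {pred E -> F} :=
  fun f => `[< linear f /\ continuous f >].

Lemma bounded_op_submod : subsemimod_closed bounded_op_pred.
Proof.
split; first split.
- apply/asboolP; split; last by move=> x; exact: cvg_cst.
  by move=> a x y; rewrite /= scaler0 addr0.
- move=> f g /asboolP[lf cf] /asboolP[lg cg]; apply/asboolP; split.
    by move=> a x y; rewrite !fctE lf lg scalerDr addrACA.
  by move=> x; apply: cvgD; [exact: cf|exact: cg].
- move=> a f /asboolP[lf cf]; apply/asboolP; split.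
    by move=> b x y; rewrite !fctE lf scalerDr !scalerA mulrC.
  by move=> x; apply: cvgZr; exact: cf.
Qed.

Record bounded_op := BoundedOp {
  bounded_op_fun :> E -> F;
  bounded_op_mem : bounded_op_fun \in bounded_op_pred }.

HB.instance Definition _ := [isSub for bounded_op_fun].
HB.instance Definition _ := [Choice of bounded_op by <:].
HB.instance Definition _ :=
  GRing.SubChoice_isSubLmodule.Build K (E -> F) bounded_op_pred bounded_op
    bounded_op_submod.

End BoundedOperators.

Notation "''L' ( E , F )" := (bounded_op E F)
  (at level 8, format "''L' ( E ,  F )") : type_scope.

Section BoundedOperatorTheory.
Variables (K : numFieldType) (E F : normedModType K).
Implicit Types (f g : 'L(E, F)) (x : E).

Lemma bounded_op_linear f : linear f.
Proof. by have /asboolP[] := bounded_op_mem f. Qed.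

Lemma bounded_op_continuous f : continuous f.
Proof. by have /asboolP[] := bounded_op_mem f. Qed.

HB.instance Definition _ f :=
  GRing.isLinear.Build K E F *:%R (bounded_op_fun f) (bounded_op_linear f).

Lemma bounded_opP f g : (forall x, f x = g x) -> f = g.
Proof. by move=> fg; apply/val_inj/funext. Qed.

Lemma bounded_opD f g x : (f + g) x = f x + g x. Proof. by []. Qed.
Lemma bounded_opZ a f x : (a *: f) x = a *: f x. Proof. by []. Qed.
Lemma bounded_op0 x : (0 : 'L(E, F)) x = 0. Proof. by []. Qed.
Lemma bounded_opN f x : (- f) x = - f x. Proof. by []. Qed.

Lemma bounded_op_bounded f :
  exists2 M : K, 0 <= M & forall x, `|f x| <= M * `|x|.
Proof.
have /linear_boundedP/pinfty_ex_gt0[M M0 fM] : bounded_near f (nbhs (0 : E)).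
  exact/linear_bounded_continuous/bounded_op_continuous.
by exists M; [exact: ltW|].
Qed.

Lemma mk_bounded_op_subproof (f : E -> F) (fl : linear f)
    (fb : exists M : K, forall x, `|f x| <= M * `|x|) :
  f \in @bounded_op_pred K E F.
Proof.
apply/asboolP; split=> //.
pose g : {linear E -> F} := HB.pack f (GRing.isLinear.Build _ _ _ _ f fl).
have [M fM] := fb.
change (continuous g); apply/linear_bounded_continuous/bounded_funP => r.
exists (`|M| * `|r|) => x xr; apply: (le_trans (fM x)).
have r0 : 0 <= r by exact: le_trans xr.
rewrite (ger0_norm r0); have [M0|] := boolP (0 <= M).
  by rewrite (ger0_norm M0) ler_wpM2l.
move=> nM; have := le_trans (normr_ge0 _) (fM x) => Mx.
have -> : M * `|x| = 0; last by rewrite mulr_ge0.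
apply/eqP; move: Mx nM; have [->|x0] := eqVneq x 0; first by rewrite normr0 mulr0.
by rewrite pmulr_lge0 ?normr_gt0// => ->.
Qed.

Definition mk_bounded_op (f : E -> F) (fl : linear f)
    (fb : exists M : K, forall x, `|f x| <= M * `|x|) : 'L(E, F) :=
  BoundedOp (mk_bounded_op_subproof fl fb).

Definition op_norm f : K := supremum 0 [set `|f x| | x in [set x | `|x| <= 1]].

End BoundedOperatorTheory.

Section OperatorNorm.
Variables (R : realType) (k : scalar_kind).
Local Notation K := (scalar_field R k).
Variables (E F : normedModType K).
Implicit Types (f g : 'L(E, F)) (x : E).

Let ball_img f := [set `|f x| | x in [set x : E | `|x| <= 1]].

Let ball_img0 f : ball_img f 0.
Proof. by exists 0; rewrite /= ?linear0 normr0// ler01. Qed.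

Let ball_img_sup f : supremums (ball_img f) !=set0.
Proof.
have [M M0 fM] := bounded_op_bounded f.
apply: (@scalar_supremums R k (ball_img f) M); first by exists 0.
  by move=> _ [x _ <-].
by move=> _ [x /= x1 <-]; apply: (le_trans (fM x)); rewrite ler_piMr.
Qed.

Let op_norm_ub f a : ball_img f a -> a <= op_norm f.
Proof.
move=> fa; have [s fs] := ball_img_sup f.
rewrite /op_norm /supremum ifF; last by apply/negP => /eqP f0; move: fa; rewrite /ball_img f0.
by case: xgetP => [y _ [yu _]|/(_ s)//]; exact: yu.
Qed.

Lemma op_norm_le f (M : K) : 0 <= M -> (forall x, `|f x| <= M * `|x|) ->
  op_norm f <= M.
Proof.
move=> M0 fM; rewrite /op_norm /supremum; case: ifPn => // _.
have [s fs] := ball_img_sup f.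
case: xgetP => [y _ [_ yl]|/(_ s)//]; apply: yl => _ [x /= x1 <-].
by apply: (le_trans (fM x)); rewrite ler_piMr.
Qed.

Lemma op_norm_ge0 f : 0 <= op_norm f.
Proof. exact: (op_norm_ub (ball_img0 f)). Qed.

Lemma ler_op_norm f x : `|f x| <= op_norm f * `|x|.
Proof.
have [->|x0] := eqVneq x 0; first by rewrite linear0 !normr0 mulr0.
have nx : 0 < `|x| by rewrite normr_gt0.
rewrite -ler_pdivrMr//.
have -> : `|f x| / `|x| = `|f (`|x|^-1 *: x)|.
  by rewrite linearZ/= normrZ normfV normr_id mulrC.
apply: op_norm_ub; exists (`|x|^-1 *: x) => //=.
by rewrite normrZ normfV normr_id mulVf ?normr_eq0.
Qed.

Let op_normD f g : op_norm (f + g) <= op_norm f + op_norm g.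
Proof.
apply: op_norm_le => [|x]; first by rewrite addr_ge0 ?op_norm_ge0.
rewrite bounded_opD mulrDl; apply: (le_trans (ler_normD _ _)).
by rewrite lerD ?ler_op_norm.
Qed.

Let op_norm_leZ (a : K) f : op_norm (a *: f) <= `|a| * op_norm f.
Proof.
apply: op_norm_le => [|x]; first by rewrite mulr_ge0 ?op_norm_ge0.
by rewrite bounded_opZ normrZ -mulrA ler_wpM2l ?ler_op_norm.
Qed.

Let op_normZ (a : K) f : op_norm (a *: f) = `|a| * op_norm f.
Proof.
apply/eqP; rewrite eq_le op_norm_leZ/=; have [->|a0] := eqVneq a 0.
  by rewrite normr0 mul0r op_norm_ge0.
rewrite -ler_pdivlMl ?normr_gt0// -normfV.
by apply: le_trans (op_norm_leZ _ _); rewrite scalerA mulVf// scale1r.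
Qed.

Let op_norm_eq0 f : op_norm f = 0 -> f = 0.
Proof.
move=> f0; apply: bounded_opP => x; apply/eqP; rewrite -normr_le0.
by rewrite (le_trans (ler_op_norm f x))// f0 mul0r.
Qed.

HB.instance Definition _ :=
  Lmodule_isNormed.Build K 'L(E, F) op_normD op_normZ op_norm_eq0.

Lemma op_normE f : `|f| = op_norm f. Proof. by []. Qed.

Lemma ler_op f x : `|f x| <= `|f| * `|x|. Proof. exact: ler_op_norm. Qed.

Lemma op_ler f (M : K) : 0 <= M -> (forall x, `|f x| <= M * `|x|) -> `|f| <= M.
Proof. exact: op_norm_le. Qed.

End OperatorNorm.

Section NormedSubspace.
Variables (K : numFieldType) (F : normedModType K) (S : submodClosed F).

Record normed_subspace := NormedSubspace {
  subspace_val :> F;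
  subspace_mem : subspace_val \in S }.

HB.instance Definition _ := [isSub for subspace_val].
HB.instance Definition _ := [Choice of normed_subspace by <:].
HB.instance Definition _ := [SubChoice_isSubLmodule of normed_subspace by <:].

Let subspace_norm (x : normed_subspace) : K := `|val x|.

Let subspace_normD x y :
  subspace_norm (x + y) <= subspace_norm x + subspace_norm y.
Proof. by rewrite /subspace_norm raddfD ler_normD. Qed.

Let subspace_normZ (a : K) x : subspace_norm (a *: x) = `|a| * subspace_norm x.
Proof. by rewrite /subspace_norm linearZ normrZ. Qed.

Let subspace_norm_eq0 x : subspace_norm x = 0 -> x = 0.
Proof. by move=> /normr0_eq0 x0; apply/val_inj; rewrite raddf0. Qed.

HB.instance Definition _ := Lmodule_isNormed.Build K normed_subspace
  subspace_normD subspace_normZ subspace_norm_eq0.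

Lemma subspace_normE (x : normed_subspace) : `|x| = `|subspace_val x|.
Proof. by []. Qed.

End NormedSubspace.

Section Composition.
Variables (R : realType) (k : scalar_kind).
Local Notation K := (scalar_field R k).
Variables (E F G : normedModType K).

Lemma comp_op_linear (U : 'L(F, G)) (V : 'L(E, F)) :
  linear (fun x => U (V x)).
Proof. by move=> a x y; rewrite !linearP. Qed.

Lemma comp_op_bounded (U : 'L(F, G)) (V : 'L(E, F)) :
  exists M, forall x, `|U (V x)| <= M * `|x|.
Proof.
exists (`|U| * `|V|) => x; apply: (le_trans (ler_op _ _)).
by rewrite -mulrA ler_wpM2l ?ler_op.
Qed.

Definition comp_op (U : 'L(F, G)) (V : 'L(E, F)) : 'L(E, G) :=
  mk_bounded_op (comp_op_linear U V) (comp_op_bounded U V).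

Lemma comp_op_norm (U : 'L(F, G)) (V : 'L(E, F)) :
  `|comp_op U V| <= `|U| * `|V|.
Proof.
apply: op_ler => [|x]; first by rewrite mulr_ge0.
apply: (le_trans (ler_op U _)).
by rewrite -mulrA ler_wpM2l ?ler_op.
Qed.

End Composition.

Section DualOperators.
Variables (R : realType) (k : scalar_kind).
Local Notation K := (scalar_field R k).

Definition dual (E : normedModType K) : normedModType K := 'L(E, K^o).

Variables (E F : normedModType K).

Lemma adj_linear (U : 'L(E, F)) :
  linear (fun phi : dual F => comp_op (phi : 'L(F, K^o)) U : dual E).
Proof. by move=> a phi psi; apply: bounded_opP. Qed.

Lemma adj_bounded (U : 'L(E, F)) : exists M, forall phi : dual F,
  `|comp_op (phi : 'L(F, K^o)) U : dual E| <= M * `|phi|.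
Proof. by exists `|U| => phi; rewrite mulrC comp_op_norm. Qed.

(* adj U = U^* *)
Definition adj (U : 'L(E, F)) : 'L(dual F, dual E) :=
  mk_bounded_op (adj_linear U) (adj_bounded U).

Lemma adjE (U : 'L(E, F)) (phi : dual F) x : adj U phi x = phi (U x).
Proof. by []. Qed.

Lemma dual_eval_linear (x : E) : linear (fun phi : dual E => phi x : K^o).
Proof. by []. Qed.

Lemma dual_eval_bounded (x : E) :
  exists M, forall phi : dual E, `|phi x : K^o| <= M * `|phi|.
Proof. by exists `|x| => phi; rewrite mulrC; exact: ler_op. Qed.

Definition dual_eval (x : E) : dual (dual E) :=
  mk_bounded_op (dual_eval_linear x) (dual_eval_bounded x).

Lemma canonical_embedding_linear : linear dual_eval.
Proof.
by move=> a x y; apply: bounded_opP => phi; exact: (linearP (phi : 'L(E, K^o))).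
Qed.

Lemma canonical_embedding_bounded :
  exists M : K, forall x, `|dual_eval x| <= M * `|x|.
Proof.
exists 1 => x; rewrite mul1r; apply: op_ler => // phi.
by rewrite mulrC; exact: (ler_op (phi : 'L(E, K^o))).
Qed.

(* the natural embedding of E into its bidual *)
Definition canonical_embedding : 'L(E, dual (dual E)) :=
  mk_bounded_op canonical_embedding_linear canonical_embedding_bounded.

End DualOperators.

Section Subspaces.
Variables (R : realType) (k : scalar_kind).
Local Notation K := (scalar_field R k).
Variables (E F : normedModType K) (S : submodClosed F).

Lemma subspace_incl_linear : linear (@subspace_val _ _ S).
Proof. by []. Qed.

Lemma subspace_incl_bounded : exists M : K,
  forall x : normed_subspace S, `|subspace_val x| <= M * `|x|.
Proof. by exists 1 => x; rewrite mul1r. Qed.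

Definition subspace_incl : 'L(normed_subspace S, F) :=
  mk_bounded_op subspace_incl_linear subspace_incl_bounded.

Section Corestriction.
Variables (W : 'L(E, F)) (WS : forall x, W x \in S).

Let corestr_fun x : normed_subspace S := NormedSubspace (WS x).

Lemma corestr_linear : linear corestr_fun.
Proof. by move=> a x y; apply/val_inj; exact: (linearP W). Qed.

Lemma corestr_bounded : exists M : K, forall x, `|corestr_fun x| <= M * `|x|.
Proof. by exists `|W| => x; exact: ler_op. Qed.

Definition corestr_of : 'L(E, normed_subspace S) :=
  mk_bounded_op corestr_linear corestr_bounded.

End Corestriction.

(* W seen as an operator into the subspace S, if W takes its values in S;
   the junk value 0 otherwise *)
Definition corestr (W : 'L(E, F)) : 'L(E, normed_subspace S) :=
  if pselect (forall x, W x \in S) is left WS then corestr_of WS else 0.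

Lemma corestrE (W : 'L(E, F)) : (forall x, W x \in S) ->
  forall x, corestr W x = W x :> F.
Proof. by rewrite /corestr; case: pselect. Qed.

End Subspaces.

Section SunDual.
Variables (R : realType) (k : scalar_kind).
Local Notation K := (scalar_field R k).

Section OneSemigroup.
Variables (E : normedModType K) (T : R -> 'L(E, E)).

(* Only the values of T at nonnegative times are meaningful. *)
Record C0_semigroup : Prop := {
  semigroup0 : forall x, T 0 x = x ;
  semigroupD : forall s t, 0 <= s -> 0 <= t -> forall x, T (s + t) x = T s (T t x) ;
  semigroup_cvg0 : forall x, T t x @[t --> 0^'+] --> x }.

Definition bounded_semigroup : Prop :=
  exists M : K, forall t, 0 <= t -> `|T t| <= M.

Definition sun_pred : {pred dual E} :=
  fun phi => `[< adj (T t) phi @[t --> 0^'+] --> phi >].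

Lemma sun_submod : subsemimod_closed sun_pred.
Proof.
split; first split.
- apply/asboolP; under eq_fun do rewrite linear0; exact: cvg_cst.
- move=> phi psi /asboolP cphi /asboolP cpsi; apply/asboolP.
  by under eq_fun do rewrite linearD; exact: cvgD.
- move=> a phi /asboolP cphi; apply/asboolP.
  by under eq_fun do rewrite linearZ; exact: cvgZr.
Qed.

HB.instance Definition _ :=
  GRing.isSubmodClosed.Build K (dual E) sun_pred sun_submod.

Definition sun : submodClosed (dual E) := sun_pred.

Definition sun_dual : normedModType K := normed_subspace sun.

Definition sun_incl : 'L(sun_dual, dual E) := subspace_incl sun.

Definition sun_semigroup (t : R) : 'L(sun_dual, sun_dual) :=
  corestr sun (comp_op (adj (T t)) sun_incl).

Lemma sunP (phi : dual E) :
  phi \in sun <-> (adj (T t) phi @[t --> 0^'+] --> phi).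
Proof. by split=> /asboolP. Qed.

Lemma sun_invariant : C0_semigroup ->
  forall t, 0 <= t -> forall phi, phi \in sun -> adj (T t) phi \in sun.
Proof.
move=> [_ TD _] t t0 phi /sunP phis; apply/sunP.
have H : adj (T t) (adj (T s) phi) @[s --> 0^'+] --> adj (T t) phi.
  apply: (@cvg_comp _ _ _ (fun s => adj (T s) phi) (adj (T t)) _ (nbhs phi)) => //.
  exact: bounded_op_continuous.
apply: cvg_trans H; apply: near_eq_cvg.
near=> s; apply: bounded_opP => x; rewrite !adjE -!TD 1?addrC//.
Unshelve. all: by end_near. Qed.

Lemma sun_semigroupE : C0_semigroup ->
  forall t, 0 <= t -> forall xs, sun_semigroup t xs = adj (T t) xs :> dual E.
Proof.
move=> T_C0 t t0 xs; rewrite /sun_semigroup corestrE// => ys.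
exact: (sun_invariant T_C0 t0 (subspace_mem ys)).
Qed.

End OneSemigroup.

Lemma sun_semigroup_C0 (E : normedModType K) (T : R -> 'L(E, E)) :
  C0_semigroup T -> C0_semigroup (sun_semigroup T).
Proof.
move=> T_C0; have [T0 TD _] := T_C0; split.
- move=> xs; apply: val_inj; rewrite /= (sun_semigroupE T_C0)//.
  by apply: bounded_opP => x; rewrite adjE T0.
- move=> s t s0 t0 xs; apply: val_inj; rewrite /= !(sun_semigroupE T_C0) ?addr_ge0//.
  by apply: bounded_opP => x; rewrite !adjE addrC TD.
move=> xs; apply/cvgrPdist_lt => e e0.
have /sunP/cvgrPdist_lt/(_ _ e0) := subspace_mem xs.
apply: filter_app; near=> t; rewrite subspace_normE /= => h.
rewrite (sun_semigroupE T_C0)//.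
Unshelve. all: by end_near. Qed.

End SunDual.

Lemma initial_ptws_cvgP (S : choiceType) (I : eqType) (V : uniformType)
    (g : S -> {ptws I -> V}) (H : set_system S) (s : S) : Filter H ->
  cvg_to H (nbhs (s : initial_topology g)) <->
    forall i, g x i @[x --> H] --> g s i.
Proof.
move=> FH; split=> [Hs i|Hs].
  have gs : g @ H --> (g s : {ptws I -> V}).
    exact: (cvg_comp _ _ Hs (@initial_continuous _ _ g s)).
  apply: (@cvg_comp _ _ _ g (fun h => h i) H (nbhs (g s : {ptws I -> V})) _ gs).
  exact: (@proj_continuous I (fun=> V : topologicalType) i (g s)).
have gs : g @ H --> (g s : {ptws I -> V}).
  apply/cvg_sup => i A; rewrite nbhsE => -[B [[C oC <-] Cs] BA].
  by apply: filterS BA _; apply: Hs; exact: open_nbhs_nbhs.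
move=> A; rewrite nbhsE => -[B [[C oC <-] Cs] BA].
by apply: filterS BA _; apply: gs; exact: open_nbhs_nbhs.
Qed.

Section Compactification.
Variables (R : realType) (k : scalar_kind).
Local Notation K := (scalar_field R k).

Section Adjoint.
Variables (E F : normedModType K).

(* For U : E -> F^*, the operator U^* j_F : F -> E^*. With F := E^* this is
   the map eta from L(E, E^** ) to L(E^* ). *)
Definition preadj (U : 'L(E, dual F)) : 'L(F, dual E) :=
  comp_op (adj U) (canonical_embedding F).

Lemma preadjE (U : 'L(E, dual F)) f e : preadj U f e = U e f.
Proof. by []. Qed.

Definition wsOT_eval (U : 'L(E, dual F)) : {ptws (E * F)%type -> K} :=
  fun p => U p.1 p.2.

(* L(E, F^* ) with the w*OT topology *)
Definition wsOT : topologicalType := initial_topology wsOT_eval.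

Lemma wsOT_cvgP (H : set_system 'L(E, dual F)) (U : 'L(E, dual F)) :
  Filter H -> cvg_to H (nbhs (U : wsOT)) <->
    forall e f, (fun V : 'L(E, dual F) => V e f : K) @ H --> (U e f : K).
Proof.
move=> FH; rewrite initial_ptws_cvgP; split => [HU e f|HU [e f]].
  exact: (HU (e, f)).
exact: HU.
Qed.

End Adjoint.

Section Semigroup.
Variables (X : normedModType K) (T : R -> 'L(X, X)).

Definition eta_map (U : 'L(X, dual (dual X))) : 'L(dual X, dual X) := preadj U.

(* the orbit {T(t) : t >= 0}, viewed in L(X, X^** ) *)
Definition semigroup_orbit : set 'L(X, dual (dual X)) :=
  [set comp_op (canonical_embedding X) (T t) | t in [set t | 0 <= t]].

Definition compactification : set 'L(X, dual (dual X)) :=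
  eta_map @^-1` @closure (wsOT (dual X) X) (eta_map @` semigroup_orbit).

Definition sun_bidual : normedModType K := sun_dual (sun_semigroup T).

(* restriction of functionals on X^* to the sun dual *)
Definition sun_restr : 'L(dual (dual X), dual (sun_dual T)) :=
  adj (sun_incl T).

(* V^sun *)
Definition sun_op (V : 'L(X, dual (dual X))) : 'L(sun_dual T, sun_dual T) :=
  corestr (sun T) (comp_op (eta_map V) (sun_incl T)).

(* For U : X -> X^{sun sun}, the map x^sun |-> U^* x^sun, with values in X^*. *)
Definition sun_adj (U : 'L(X, sun_bidual)) : 'L(sun_dual T, dual X) :=
  preadj (comp_op (sun_incl (sun_semigroup T)) U).

(* U^{sun *} *)
Definition sun_adj_adj (U : 'L(X, sun_bidual)) :
    'L(dual (sun_dual T), dual (sun_dual T)) :=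
  adj (corestr (sun T) (sun_adj U)).

Definition L_T : set 'L(X, sun_bidual) :=
  [set U | (forall xs, sun_adj U xs \in sun T) /\
           (forall phi, phi \in sun (sun_semigroup T) ->
                        sun_adj_adj U phi \in sun (sun_semigroup T))].

Definition kappa_eval (U : L_T) : {ptws (X * sun_dual T)%type -> K} :=
  fun p => (val U p.1 : dual (sun_dual T)) p.2.

(* L_T(X, X^{sun sun}) with the topology kappa^{sun sun} *)
Definition kappa : topologicalType := initial_topology kappa_eval.

Lemma kappa_cvgP (H : set_system L_T) (U : L_T) :
  Filter H -> cvg_to H (nbhs (U : kappa)) <->
    forall x (xs : sun_dual T),
      (fun V : L_T => kappa_eval V (x, xs)) @ H --> kappa_eval U (x, xs).
Proof.
move=> FH; rewrite initial_ptws_cvgP; split => [HU x xs|HU [x xs]].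
  exact: (HU (x, xs)).
exact: HU.
Qed.

(* U is V, once the values of V are restricted to the sun dual *)
Definition restricts_to (V : 'L(X, dual (dual X))) (U : 'L(X, sun_bidual)) :=
  forall x, sun_restr (V x) = U x :> dual (sun_dual T).

End Semigroup.
End Compactification.

Arguments L_T {R k X} T _.

(* Main.v *)
(* The identity [V (T t x) f = V x (adj (T t) f)] and the bound
   [|V x f| <= M |x| |f|] hold on the orbit and are closed under w*OT limits,
   hence hold for all V in the compactification. The bound gives compactness as
   in Banach-Alaoglu: along an ultrafilter the bounded scalars [V x f] converge,
   and their limits define an operator. The identity says that [eta_map V]
   commutes with [adj (T t)], and a bounded operator that commutes with the
   adjoint semigroup preserves strong continuity of its orbits, hence the sun
   dual; the same argument one level up handles the sun bidual. Finally [V x] is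
   the image of [x], which lies in the sun bidual, under [adj (sun_op T V)]. *)
Require Import Defs.
From HB Require Import structures.
From mathcomp Require Import all_boot all_order all_algebra.
From mathcomp Require Import complex.
From mathcomp Require Import all_classical all_reals.
From mathcomp Require Import topology normedtype.

Set Implicit Arguments.
Unset Strict Implicit.
Unset Printing Implicit Defensive.

Import Order.TTheory GRing.Theory Num.Def Num.Theory.
Import numFieldNormedType.Exports.

Local Open Scope classical_set_scope.
Local Open Scope ring_scope.

(** * Convergence of bounded scalars along ultrafilters *)

Lemma ultra_fmap (S U : Type) (f : S -> U) (F : set_system S) :
  UltraFilter F -> UltraFilter (f @ F).
Proof.
move=> FU; apply: Build_UltraFilter => G GP FG; apply/seteqP; split => // A GA.
have [//|FnA] := in_ultra_setVsetC (f @^-1` A) FU.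
have GnA : G (~` A) by exact: FG.
by have [y [Ay]] := @filter_ex _ G _ _ (filterI GA GnA).
Qed.

Lemma real_ultra_cvg (R : realType) (F : set_system R) (M : R) :
  UltraFilter F -> F [set r | `|r| <= M] -> exists r : R, F --> r.
Proof.
move=> FU FM; have := @segment_compact R (- M) M.
rewrite compact_ultra => /(_ F FU) [|r [_ Fr]]; last by exists r.
by apply: filterS FM => r /=; rewrite in_itv/= ler_norml.
Qed.

Section ComplexNorm.
Variable R : realType.
Implicit Type z : R[i]%C.

Lemma normRe_le z : `|complex.Re z| <= complex.Re `|z|.
Proof. by rewrite normc_def -sqrtr_sqr ler_wsqrtr// lerDl sqr_ge0. Qed.

Lemma normIm_le z : `|complex.Im z| <= complex.Re `|z|.
Proof. by rewrite normc_def -sqrtr_sqr ler_wsqrtr// lerDr sqr_ge0. Qed.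

Lemma normc_le z : `|z| <= (`|complex.Re z| + `|complex.Im z|)%:C%C.
Proof.
rewrite normc_def lecR -[leRHS]ger0_norm ?addr_ge0// -sqrtr_sqr ler_wsqrtr//.
rewrite -(real_normK (num_real (complex.Re z))).
rewrite -(real_normK (num_real (complex.Im z))).
by rewrite sqrrD lerD2r lerDl mulrn_wge0 ?mulr_ge0.
Qed.

End ComplexNorm.

Lemma scalar_cvgP (K : numFieldType) (S : Type) (F : set_system S)
    (f : S -> K) (l : K) :
  Filter F -> (forall e, 0 < e -> \forall s \near F, `|l - f s| <= e) -> f @ F --> l.
Proof. by move=> FF h; apply/(@cvgrPdist_le K K^o). Qed.

Lemma scalar_ultra_cvg (R : realType) (k : scalar_kind) (S : Type)
    (F : set_system S) (f : S -> scalar_field R k) (M : scalar_field R k) :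
  UltraFilter F -> (\forall s \near F, `|f s| <= M) ->
  exists z : scalar_field R k, f @ F --> z.
Proof.
case: k f M => /= f M FU FM.
  by apply: (@real_ultra_cvg R (f @ F) M) => //; exact: ultra_fmap.
(* Complex case: [|f s| <= M] in the partial order of the complex numbers compares real parts, so
   [complex.Re M] bounds both coordinates of [f s]. *)
have FRe : exists r : R, (fun s => complex.Re (f s)) @ F --> r.
  apply: (@real_ultra_cvg R _ (complex.Re M)); first exact: ultra_fmap.
  apply: filterS FM => s /=; rewrite lecE => /andP[_].
  exact: le_trans (normRe_le _).
have FIm : exists r : R, (fun s => complex.Im (f s)) @ F --> r.
  apply: (@real_ultra_cvg R _ (complex.Re M)); first exact: ultra_fmap.
  apply: filterS FM => s /=; rewrite lecE => /andP[_].
  exact: le_trans (normIm_le _).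
have [[a Fa] [b Fb]] := (FRe, FIm).
exists (a +i* b)%C.
apply: (@scalar_cvgP (complex R) S F f) => e e0.
have eE : e = ((complex.Re e)%:C)%C by rewrite RRe_real// gtr0_real.
have e20 : 0 < complex.Re e / 2 by rewrite divr_gt0// -ltcR -eE.
move/cvgrPdist_le : Fa => /(_ _ e20); move/cvgrPdist_le : Fb => /(_ _ e20).
apply: filterS2 => s bs as_; apply: (le_trans (normc_le _)).
rewrite eE lecR [leRHS]splitr lerD//; first by move: as_; case: (f s).
by move: bs; case: (f s).
Qed.

(** One point of the filter within [e] of the limit suffices for each [e]; this works over a
    partially ordered [K]. *)
Lemma norm_cvg_le (K : numFieldType) (V : normedModType K) (S : Type)
    (F : set_system S) (f : S -> V) (l : V) (c : K) :
  ProperFilter F -> f @ F --> l -> (\forall s \near F, `|f s| <= c) ->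
  `|l| <= c.
Proof.
move=> FP Fl Fc; apply/ler_addgt0Pr => e e0.
move/cvgrPdist_le : Fl => /(_ _ e0) Fe.
have [s [sc se]] := filter_ex (filterI Fc Fe).
by rewrite -(subrK (f s) l) addrC (le_trans (ler_normD _ _))// lerD.
Qed.

(** * Banach-Alaoglu for the w*OT topology *)

Section WsOTCompact.
Variables (R : realType) (k : scalar_kind).
Local Notation K := (scalar_field R k).
Variables (E F : normedModType K).

(** Turns a pointwise limit, which is only a scalar function of two arguments, into an operator. *)
Lemma bilinear_op (b : E -> F -> K) (M : K) : 0 <= M ->
  (forall a x y f, b (a *: x + y) f = a * b x f + b y f) ->
  (forall x a f g, b x (a *: f + g) = a * b x f + b x g) ->
  (forall x f, `|b x f| <= M * `|x| * `|f|) ->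
  exists V : 'L(E, dual F), forall x f, V x f = b x f.
Proof.
move=> M0 bl br bM.
pose B x : dual F := mk_bounded_op (br x : linear (b x : F -> K^o))
  (ex_intro _ (M * `|x|) (bM x)).
have Bl : linear B by move=> a x y; apply: bounded_opP => f; exact: bl.
have BM : exists M : K, forall x, `|B x| <= M * `|x|.
  by exists M => x; apply: op_ler; [rewrite mulr_ge0|exact: bM].
by exists (mk_bounded_op Bl BM).
Qed.

(** The limits are chosen separately for each pair [x], [f]; uniqueness of limits makes the choice
    bilinear, and the uniform bound survives by [norm_cvg_le]. *)
Lemma wsOT_ultra_cvg (G : set_system 'L(E, dual F)) (M : K) :
  UltraFilter G -> 0 <= M ->
  G [set W : 'L(E, dual F) | forall x f, `|W x f : K| <= M * `|x| * `|f|] ->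
  exists V : 'L(E, dual F), G --> (V : wsOT E F).
Proof.
move=> GU M0 GM.
have lim x f : {z : K | (fun W : 'L(E, dual F) => W x f : K) @ G --> z}.
  apply/cid/(@scalar_ultra_cvg R k _ G _ (M * `|x| * `|f|)).
  by apply: filterS GM => W; apply.
pose b x f : K^o := sval (lim x f).
have bP x f : (fun W : 'L(E, dual F) => W x f : K^o) @ G --> b x f.
  exact: svalP (lim x f).
have uniq x f z : (fun W : 'L(E, dual F) => W x f : K^o) @ G --> z -> b x f = z.
  exact: (@cvg_unique _ (@norm_hausdorff K K^o) _ _ _ _ (bP x f)).
have [|||V VE] := @bilinear_op b M M0.
- move=> a x y f; apply: uniq.
  under eq_fun do rewrite linearP.
  by apply: cvgD; [apply: cvgZl_tmp; exact: bP|exact: bP].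
- move=> x a f g; apply: uniq.
  under eq_fun => W do rewrite (linearP (W x : 'L(F, K^o))).
  by apply: cvgD; [apply: cvgZl_tmp; exact: bP|exact: bP].
- move=> x f; apply: (norm_cvg_le (V := K^o) _ (bP x f)).
  by apply: filterS GM => W; apply.
by exists V; apply/wsOT_cvgP => x f; rewrite VE; exact: bP.
Qed.

End WsOTCompact.

(** Norm continuity of [W] carries the limit at [0] of the orbit of [phi] to that of [W phi]. It
    serves both levels: the sun dual and the sun bidual. *)
Lemma sun_intertwine (R : realType) (k : scalar_kind)
    (E F : normedModType (scalar_field R k)) (S : R -> 'L(E, E))
    (T : R -> 'L(F, F)) (W : 'L(dual E, dual F)) :
  (forall phi t, 0 < t -> W (adj (S t) phi) = adj (T t) (W phi)) ->
  forall phi, phi \in sun S -> W phi \in sun T.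
Proof.
move=> ST phi /sunP phiS; apply/sunP.
have : W (adj (S t) phi) @[t --> 0^'+] --> W phi.
  apply: (@cvg_comp _ _ _ (fun t => adj (S t) phi) W _ (nbhs phi)) => //.
  exact: bounded_op_continuous.
apply: cvg_trans; apply: near_eq_cvg; near=> t.
by rewrite ST.
Unshelve. all: by end_near. Qed.

(** * Limits of the orbit *)

Section Compactification.
Variables (R : realType) (k : scalar_kind).
Local Notation K := (scalar_field R k).
Variables (X : normedModType K) (T : R -> 'L(X, X)).
Hypothesis (T_C0 : C0_semigroup T).
Implicit Type V : 'L(X, dual (dual X)).

(** The members of the orbit are sent by [eta_map] to the adjoints of [T t], so a filter witnessing
    the closure lives on those adjoints. *)
Lemma compactification_filter V : compactification T V ->
  exists2 G : set_system 'L(dual X, dual X),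
    ProperFilter G /\ G [set adj (T t) | t in [set t | 0 <= t]] &
    forall (x : X) (f : dual X),
      (fun W : 'L(dual X, dual X) => W f x : K) @ G --> (V x f : K).
Proof.
rewrite /compactification /= closureEcvg => -[G GP [GV GS]].
exists G.
  split=> //; apply: (filterS _ (GS _ (fun _ => id))) => _ [_ [t t0 <-] <-].
  by exists t => //; apply: bounded_opP => f; apply: bounded_opP.
by move=> x f; move/wsOT_cvgP : GV; apply.
Qed.

Lemma compactification_bound V (M : K) : (forall t, 0 <= t -> `|T t| <= M) ->
  compactification T V -> forall x f, `|V x f : K| <= M * `|x| * `|f|.
Proof.
move=> TM /compactification_filter[G [GP GT] GV] x f.
apply: (norm_cvg_le (V := K^o) GP (GV x f)).
apply: filterS GT => _ [t t0 <-]; rewrite adjE (le_trans (ler_op f _))//.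
by rewrite mulrC ler_wpM2r// (le_trans (ler_op _ _))// ler_wpM2r// TM.
Qed.

(** The semigroup is commutative, so both sides are limits of the same scalars along [G]. *)
Lemma compactification_comm V : compactification T V ->
  forall t, 0 <= t -> forall x f, V (T t x) f = V x (adj (T t) f).
Proof.
move=> /compactification_filter[G [GP GT] GV] t t0 x f.
apply: (@cvg_unique _ (@norm_hausdorff K K^o) _ _ _ _ (GV _ _)).
apply: cvg_trans (GV x (adj (T t) f)); apply: near_eq_cvg.
apply: filterS GT => _ [s s0 <-]; have [_ TD _] := T_C0.
by rewrite !adjE -!TD// addrC.
Qed.

Lemma compactification_compact : bounded_semigroup T ->
  @compact (wsOT X (dual X)) (compactification T).
Proof.
move=> [M TM]; rewrite compact_ultra => F FU FT.
have M0 : 0 <= M by rewrite (le_trans _ (TM 0 _)).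
have [|V FV] := @wsOT_ultra_cvg R k X (dual X) F M FU M0.
  by apply: filterS FT => V TV; exact: (compactification_bound TM).
exists V; split=> //; rewrite /compactification/=.
have FP : ProperFilter F by exact: ultra_proper.
(* Membership of the limit: [eta_map] only swaps the two arguments of the evaluation, hence respects
   w*OT limits, and the closure is closed. *)
apply: (@closed_cvg _ (wsOT (dual X) X) F FP (@eta_map R k X) _
  (@closed_closure _ _) FT).
apply/wsOT_cvgP => f x; exact: ((wsOT_cvgP V FP).1 FV x f).
Qed.

(** The embedding of [X] intertwines [T] with the adjoint of the sun semigroup, so strong continuity
    of [T] is transported. *)
Lemma canonical_embedding_sun (x : X) :
  sun_restr T (canonical_embedding X x) \in sun (sun_semigroup T).
Proof.
apply/sunP.
have : sun_restr T (canonical_embedding X (T t x)) @[t --> 0^'+] -->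
    sun_restr T (canonical_embedding X x).
  have [_ _ Tx] := T_C0.
  pose W := comp_op (sun_restr T) (canonical_embedding X).
  apply: (@cvg_comp _ _ _ (fun t => T t x) W _ (nbhs x)); first exact: Tx.
  exact: (@bounded_op_continuous _ _ _ W).
apply: cvg_trans; apply: near_eq_cvg; near=> t.
by apply: bounded_opP => xs; rewrite !adjE /= sun_semigroupE.
Unshelve. all: by end_near. Qed.

(** * Action on the sun dual and the sun bidual *)

Section CompactificationElement.
Variables (V : 'L(X, dual (dual X))) (TV : compactification T V).

Lemma eta_map_comm (f : dual X) t : 0 <= t ->
  eta_map V (adj (T t) f) = adj (T t) (eta_map V f).
Proof.
by move=> t0; apply: bounded_opP => x; exact/esym/compactification_comm.
Qed.

Lemma eta_map_sun (f : dual X) : f \in sun T -> eta_map V f \in sun T.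
Proof. by apply: sun_intertwine => g t t0; apply/eta_map_comm/ltW. Qed.

Lemma sun_opE (xs : sun_dual T) : sun_op T V xs = eta_map V xs :> dual X.
Proof.
by rewrite /sun_op corestrE// => ys; exact/eta_map_sun/subspace_mem.
Qed.

Lemma sun_op_comm (xs : sun_dual T) t : 0 <= t ->
  sun_op T V (sun_semigroup T t xs) = sun_semigroup T t (sun_op T V xs).
Proof.
move=> t0; apply/val_inj => /=.
by rewrite sun_opE !sun_semigroupE// sun_opE eta_map_comm.
Qed.

Lemma adj_sun_op_sun phi : phi \in sun (sun_semigroup T) ->
  adj (sun_op T V) phi \in sun (sun_semigroup T).
Proof.
apply: sun_intertwine => psi t t0.
by apply: bounded_opP => xs; rewrite !adjE sun_op_comm// ltW.
Qed.

Lemma compactification_sun_bidual (x : X) :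
  sun_restr T (V x) \in sun (sun_semigroup T).
Proof.
have -> : sun_restr T (V x) =
    adj (sun_op T V) (sun_restr T (canonical_embedding X x)).
  by apply: bounded_opP => xs; rewrite !adjE /= sun_opE.
exact/adj_sun_op_sun/canonical_embedding_sun.
Qed.

Lemma compactification_L_T : exists2 U, L_T T U & restricts_to V U.
Proof.
pose U : 'L(X, sun_bidual T) :=
  corestr (sun (sun_semigroup T)) (comp_op (sun_restr T) V).
have VU : restricts_to V U.
  by move=> x; rewrite /U corestrE// => y; exact: compactification_sun_bidual.
(* With this equality [sun_adj_adj U] becomes [adj (sun_op T V)]. *)
have UV : sun_adj U = comp_op (eta_map V) (sun_incl T).
  apply: bounded_opP => xs; apply: bounded_opP => x.
  by rewrite /sun_adj preadjE/= -VU.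
exists U => //; split=> [xs|phi phis].
  by rewrite UV; exact/eta_map_sun/subspace_mem.
by rewrite /sun_adj_adj UV; exact: adj_sun_op_sun.
Qed.

End CompactificationElement.

(** The set is the image of the compactification under restriction to the sun dual: an ultrafilter
    is lifted to the compactification, converges there, and its limit is restricted back. *)
Lemma kappa_compact : bounded_semigroup T ->
  @compact (kappa T)
    [set U : L_T T | exists2 V, compactification T V & restricts_to V (val U)].
Proof.
move=> T_bounded; rewrite compact_ultra => F FU FT.
(* The default [0] is taken only at [U] that restrict no element of the compactification, and [F]
   avoids these. *)
pose lift (U : L_T T) : 'L(X, dual (dual X)) :=
  xget 0 [set V | compactification T V /\ restricts_to V (val U)].
have liftP : \forall U \near F,
    compactification T (lift U) /\ restricts_to (lift U) (val U).
  apply: filterS FT => U [V TV VU]; rewrite /lift.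
  by case: xgetP => [W _ //|/(_ V) []].
have := compactification_compact T_bounded; rewrite compact_ultra.
have lU : UltraFilter (lift @ F) by exact: ultra_fmap.
move=> /(_ _ lU) [|V [TV FV]]; first by apply: filterS liftP => U [].
have [U LU VU] := compactification_L_T TV.
have LU' : U \in L_T T by rewrite inE.
exists (exist _ U LU'); split; first by exists V.
have FP : ProperFilter F by exact: ultra_proper.
apply/kappa_cvgP => x xs; rewrite /kappa_eval /= -VU.
have : (fun W => lift W x xs : K) @ F --> (V x xs : K).
  exact: ((wsOT_cvgP V _).1 FV x xs).
apply: cvg_trans; apply: near_eq_cvg.
by apply: filterS liftP => W [_ /(_ x) <-].
Qed.

End Compactification.

Theorem theorem3p3 (R : realType) (k : scalar_kind)
    (X : completeNormedModType (scalar_field R k)) (T : R -> 'L(X, X))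
    (T_C0 : C0_semigroup T) (T_bounded : bounded_semigroup T) :
  [/\ @compact (wsOT X (dual X)) (compactification T),
      forall V, compactification T V ->
        [/\ forall (xs : sun_dual T) (t : R), 0 <= t ->
              eta_map V (adj (T t) xs) = adj (T t) (eta_map V xs),
            forall xs : sun_dual T, eta_map V xs \in sun T,
            forall phi, phi \in sun (sun_semigroup T) ->
              adj (sun_op T V) phi \in sun (sun_semigroup T)
          & forall x, sun_restr T (V x) \in sun (sun_semigroup T)],
      forall V, compactification T V ->
        exists2 U, L_T T U & restricts_to V U
    & @compact (kappa T)
        [set U : L_T T | exists2 V, compactification T V & restricts_to V (val U)]].
Proof.
split.
- exact: compactification_compact.
- move=> V TV; split.
  + by move=> xs t; exact: eta_map_comm.
  + by move=> xs; exact/eta_map_sun/subspace_mem.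
  + exact: adj_sun_op_sun.
  + exact: compactification_sun_bidual.
- by move=> V; exact: compactification_L_T.
- exact: kappa_compact.
Qed.
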